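(* Let $A\in\mathbb{R}^{n\times n}$, $B\in\mathbb{R}^{n\times m}$, $Q=Q^T\ge 0$ in $\mathbb{R}^{n\times n}$ and $R=R^T>0$ in $\mathbb{R}^{m\times m}$. Suppose $(A,B)$ is stabilizable and $(A,\sqrt{Q})$ is detectable. Let $P^*$ be the unique positive semi-definite solution of $$A^TP^*+P^*A+Q-P^*BR^{-1}B^TP^*=0,$$ and let $K^*=-R^{-1}B^TP^*$. Let $K_0\in\mathbb{R}^{m\times n}$ be any matrix such that $A+BK_0$ is Hurwitz, and let $(P_k)_{k\ge0}$, $(K_k)_{k\ge 0}$ be generated by Kleinman's algorithm: for $k=0,1,2,\dots$, with $A_k=A+BK_k$, $$0=A_k^TP_k+P_kA_k+Q+K_k^TRK_k,\qquad K_{k+1}=-R^{-1}B^TP_k.$$ Then, for all $k\in\mathbb{N}$ (including $k=0$): 1. all eigenvalues of $A_k$ lie in the open left half-plane; 2. $P^*\le P_{k+1}\le P_k$; 3. $\lim_{k\to\infty}K_k=K^*$ and $\lim_{k\to\infty}P_k=P^*$.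
   Context: $\sqrt{Q}$ denotes the unique positive semi-definite square root of $Q$. Inequalities between symmetric matrices are in the positive semi-definite (Loewner) order. It is a known fact that, when $(A,B)$ is stabilizable and $(A,\sqrt{Q})$ is detectable, the algebraic Riccati equation in the claim has a unique positive semi-definite solution. A matrix is Hurwitz if all its eigenvalues have negative real part. *)

(* Defs.v *)
From HB Require Import structures.
From mathcomp Require Import all_boot all_order all_algebra.
From mathcomp Require Import complex.
From mathcomp Require Import all_classical all_reals all_analysis.

Set Implicit Arguments.
Unset Strict Implicit.
Unset Printing Implicit Defensive.

Import Order.TTheory GRing.Theory Num.Theory.
Import numFieldNormedType.Exports.

Local Open Scope ring_scope.

(* All definiteness notions include symmetry: over the reals the sign of the
   quadratic form only constrains the symmetric part of the matrix. *)
Definition psdmx (F : realType) (n : nat) (M : 'M[F]_n) : Prop :=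
  M^T = M /\ forall x : 'cV[F]_n, 0 <= (x^T *m M *m x) 0 0.

Definition pdmx (F : realType) (n : nat) (M : 'M[F]_n) : Prop :=
  M^T = M /\ forall x : 'cV[F]_n, x != 0 -> 0 < (x^T *m M *m x) 0 0.

Definition loewner_le (F : realType) (n : nat) (M N : 'M[F]_n) : Prop :=
  psdmx (N - M).

(* This relation determines S from Q. *)
Definition is_psd_sqrt (F : realType) (n : nat) (Q S : 'M[F]_n) : Prop :=
  psdmx S /\ S *m S = Q.

(* The eigenvalues of a real matrix are taken in the complex field F[i]. *)
Definition hurwitz (F : realType) (n : nat) (A : 'M[F]_n) : Prop :=
  forall z : complex F,
    eigenvalue (map_mx (real_complex F) A) z -> complex.Re z < 0.

Definition stabilizable (F : realType) (n m : nat)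
    (A : 'M[F]_n) (B : 'M[F]_(n, m)) : Prop :=
  exists K : 'M[F]_(m, n), hurwitz (A + B *m K).

Definition detectable (F : realType) (n p : nat)
    (A : 'M[F]_n) (C : 'M[F]_(p, n)) : Prop :=
  exists L : 'M[F]_(n, p), hurwitz (A + L *m C).

Definition riccati_eq (F : realType) (n m : nat) (A : 'M[F]_n)
    (B : 'M[F]_(n, m)) (Q : 'M[F]_n) (R : 'M[F]_m) (P : 'M[F]_n) : Prop :=
  A^T *m P + P *m A + Q - P *m B *m invmx R *m B^T *m P = 0.

Definition lqr_gain (F : realType) (n m : nat)
    (B : 'M[F]_(n, m)) (R : 'M[F]_m) (P : 'M[F]_n) : 'M[F]_(m, n) :=
  - (invmx R *m B^T *m P).

Definition kleinman_iteration (F : realType) (n m : nat) (A : 'M[F]_n)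
    (B : 'M[F]_(n, m)) (Q : 'M[F]_n) (R : 'M[F]_m) (K0 : 'M[F]_(m, n))
    (P : nat -> 'M[F]_n) (K : nat -> 'M[F]_(m, n)) : Prop :=
  K 0%N = K0 /\
  forall k : nat,
    let Ak := A + B *m K k in
    0 = Ak^T *m P k + P k *m Ak + Q + (K k)^T *m R *m K k /\
    K k.+1 = lqr_gain B R (P k).

(* Main.v *)
Require Import Defs.
From mathcomp Require Import all_boot all_order all_algebra.
From mathcomp Require Import complex ring.
From mathcomp Require Import all_classical all_reals all_analysis.
Import Order.TTheory GRing.Theory Num.Theory.
Import numFieldNormedType.Exports.
Local Open Scope classical_set_scope.
Local Open Scope ring_scope.

Set Implicit Arguments.
Unset Strict Implicit.
Unset Printing Implicit Defensive.

(** Call [(A + B L)^T P + P (A + B L) + Q + L^T R L] the residual of [P] under the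
    feedback [L]. Kleinman's [P k] is the matrix of zero residual under [K k], and
    [Pstar] has zero residual under its own gain. Three facts carry the proof.

    - Completing the square ([complete_square]): for symmetric [P], the residual
      of [P] under [L] is the Riccati residual of [P] plus
      [(L - G)^T R (L - G)], where [G] is the gain of [P].
    - Comparison ([policy_residual_le]): if [A + B L] is Hurwitz, a larger
      residual under [L] means a smaller matrix. This is the Lyapunov theorem
      that [M^T X + X M + W = 0] with [M] Hurwitz and [W >= 0] forces [X >= 0].
    - Stability ([detectable_policy_hurwitz]): if a positive semi-definite [P]
      has a nonpositive residual under [L], detectability makes [A + B L]
      Hurwitz.

    Suppose that [A + B K k] is Hurwitz. Then [P k >= 0] by the Lyapunov theorem.
    The residual of [P k] is zero under [K k], so under its own gain [K k.+1] it
    is minus a square; hence [A + B K k.+1] is Hurwitz, and comparison under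
    [K k.+1] gives [P k.+1 <= P k]. The residual of [Pstar] under [K k] is a
    square, so comparison gives [Pstar <= P k].

    A decreasing sequence of symmetric matrices that is bounded below converges,
    so [P k] tends to some [Pinf >= Pstar], and [K k] tends to its gain. In the
    limit [Pinf] solves the Riccati equation. Its residual under the gain of
    [Pstar] is therefore a square, that gain is stabilizing, and comparison gives
    [Pinf <= Pstar]. Thus [Pinf = Pstar], with uniqueness of the semi-definite
    solution obtained on the way.

    The Lyapunov theorem is proved by algebra:
    after a unitary change of basis over the complex numbers [M] is triangular,
    and induction on the size peels off one eigenvector, replacing [X] by a Schur
    complement ([hpsdmx_lyapunov_trig]). *)

(** * Hermitian positive semi-definite matrices *)

Section HermitianPsd.
Local Open Scope sesquilinear_scope.
Variable C : numClosedFieldType.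

Definition qform n (X : 'M[C]_n) (v : 'cV[C]_n) : C := (v ^t* *m X *m v) 0 0.

Definition hpsdmx n (X : 'M[C]_n) : Prop :=
  X ^t* = X /\ forall v : 'cV[C]_n, 0 <= qform X v.

Lemma mulmx_adj m n p (M : 'M[C]_(m, n)) (N : 'M[C]_(n, p)) :
  (M *m N) ^t* = N ^t* *m M ^t*.
Proof. by rewrite trmx_mul map_mxM. Qed.

Lemma addmx_adj m n (M N : 'M[C]_(m, n)) : (M + N) ^t* = M ^t* + N ^t*.
Proof. by apply/matrixP => i j; rewrite !mxE rmorphD. Qed.

Lemma oppmx_adj m n (M : 'M[C]_(m, n)) : (- M) ^t* = - M ^t*.
Proof. by apply/matrixP => i j; rewrite !mxE rmorphN. Qed.

Lemma scalemx_adj m n (a : C) (M : 'M[C]_(m, n)) : (a *: M) ^t* = a^* *: M ^t*.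
Proof. by apply/matrixP => i j; rewrite !mxE rmorphM. Qed.

Lemma scalar_mx_adj n (a : C) : (a%:M : 'M[C]_n) ^t* = a^*%:M.
Proof. by rewrite tr_scalar_mx map_scalar_mx. Qed.

Lemma block_mx_adj m n p q (a : 'M[C]_(m, n)) (b : 'M[C]_(m, p))
    (c : 'M[C]_(q, n)) (d : 'M[C]_(q, p)) :
  (block_mx a b c d) ^t* = block_mx (a ^t*) (c ^t*) (b ^t*) (d ^t*).
Proof. by rewrite tr_block_mx map_block_mx. Qed.

Lemma adj_mul_ge0 n (v : 'cV[C]_n) : 0 <= (v ^t* *m v) 0 0.
Proof. by rewrite mxE sumr_ge0 // => i _; rewrite !mxE mulrC mul_conjC_ge0. Qed.

Lemma adj_mul_eq0 n (v : 'cV[C]_n) : (v ^t* *m v) 0 0 = 0 -> v = 0.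
Proof.
rewrite mxE => /eqP; rewrite psumr_eq0; last first.
  by move=> i _; rewrite !mxE mulrC mul_conjC_ge0.
move=> /allP v0; apply/colP => i; apply/eqP.
have := v0 i (mem_index_enum i).
by rewrite /= !mxE mulrC mul_conjC_eq0.
Qed.

Lemma hpsdmx_congr m n (G : 'M[C]_(m, n)) (X : 'M[C]_n) :
  hpsdmx X -> hpsdmx (G *m X *m G ^t*).
Proof.
move=> [Xh X0]; split; first by rewrite !mulmx_adj Xh trmxCK mulmxA.
by move=> v; have := X0 (G ^t* *m v); rewrite /qform mulmx_adj trmxCK !mulmxA.
Qed.

(** The Cauchy-Schwarz argument: if [W v] were nonzero, moving from [W v] along
    [- v] would change the form linearly (its quadratic term is [qform W v = 0])
    and eventually make it negative. *)
Lemma hpsdmx_ker n (W : 'M[C]_n) (v : 'cV[C]_n) :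
  hpsdmx W -> qform W v = 0 -> W *m v = 0.
Proof.
move=> [Wh W0] Wv0; apply: adj_mul_eq0.
set s := (X in X = 0); apply: contra_eq (Wv0) => s0; exfalso.
have sgt0 : 0 < s by rewrite lt_def s0 adj_mul_ge0.
pose q := qform W (W *m v); have q0 : 0 <= q by exact: W0.
(* The form at [W v - t v] is [q - 2 t s], which this [t] makes [- (q + 2)]. *)
pose t := (q + 1) / s.
have tR : t^* = t by apply/CrealP/ger0_real; rewrite divr_ge0 ?addr_ge0 // ltW.
have := W0 (W *m v - t *: v); suff -> : qform W (W *m v - t *: v) = - (q + 2).
  by rewrite lt_geF // oppr_lt0 ltr_wpDl.
have qE : qform W (W *m v - t *: v)
    = q - t * s - t * s + t ^+ 2 * qform W v.
  rewrite /qform addmx_adj oppmx_adj scalemx_adj tR !mulmx_adj Wh.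
  rewrite !(mulmxDl, mulmxDr, mulNmx, mulmxN, =^~scalemxAl, =^~scalemxAr).
  rewrite /q /qform /s !mulmx_adj Wh !mulmxA.
  move: (v ^t* *m W *m W *m W *m v) (v ^t* *m W *m W *m v) (v ^t* *m W *m v).
  by move=> x y z; rewrite !mxE; ring.
by rewrite qE Wv0 /t divfK //; ring.
Qed.

Lemma hpsdmx_block_diag n (a : C) (X : 'M[C]_n) :
  0 <= a -> hpsdmx X -> hpsdmx (block_mx a%:M 0 0 X : 'M[C]_(1 + n)).
Proof.
move=> a0 [Xh X0]; split.
  rewrite block_mx_adj Xh scalar_mx_adj !trmx0 !map_mx0.
  by rewrite (CrealP (ger0_real a0)).
move=> v; rewrite /qform -(vsubmxK v) tr_col_mx map_row_mx.
rewrite mul_row_block !mulmx0 add0r addr0 mul_row_col mxE addr_ge0 //.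
  rewrite mul_mx_scalar -scalemxAl mxE mulr_ge0 ?adj_mul_ge0 //.
exact: X0.
Qed.

(** Used below with [c] the conjugate of an eigenvalue of a stable matrix: no two
    eigenvalues in the open left half-plane satisfy [lambda + mu^* = 0]. *)
Lemma trig_add_scalar_unit n (N : 'M[C]_n) (c : C) :
  is_trig_mx N -> (forall i, N i i + c != 0) -> N + c%:M \in unitmx.
Proof.
move=> /is_trig_mxP Nt Nc; rewrite unitmxE det_trig; last first.
  by apply/is_trig_mxP => i j ij; rewrite !mxE Nt // add0r -val_eqE /= ltn_eqF.
rewrite unitfE; apply/prodf_neq0 => i _.
by rewrite !mxE eqxx Nc.
Qed.

(** The Lyapunov theorem for a triangular [N], by induction on the size. Write
    [N = (l 0; b N')] and [X = (a y; z X')]. The corner of the equation is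
    [(l + l^* ) a = - w] with [w >= 0], so [a >= 0]. The off-diagonal
    blocks give [y^*] and [z] as solutions of one nonsingular linear system, so
    [z = y^*]; and if [a = 0], then [w = 0], the first column of [W] vanishes
    because [W] is semi-definite, and so [y = 0]. In both cases [y = a s] for
    some row [s], and a block elimination reduces the equation to one for the
    Schur complement [X' - a s^* s], to which the induction applies. *)
Lemma hpsdmx_lyapunov_trig n (N X W : 'M[C]_n) :
  is_trig_mx N -> (forall i, N i i + (N i i)^* < 0) -> hpsdmx W ->
  N *m X + X *m N ^t* + W = 0 -> hpsdmx X.
Proof.
move=> Ntrig; elim/trigsqmx_ind: {n} N / Ntrig X W => [|n N11 b N' N't IHn] X W.
  move=> _ _ _; rewrite [X]thinmx0; split; first by rewrite trmx0 map_mx0.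
  by move=> v; rewrite /qform mulmx0 mul0mx mxE.
rewrite (mx11_scalar N11); move: (N11 0 0) => l {N11} Nneg.
rewrite -(submxK X) -(submxK W).
rewrite (mx11_scalar (ulsubmx X)) (mx11_scalar (ulsubmx W)).
move: (ulsubmx X 0 0) (ursubmx X) (dlsubmx X) (drsubmx X) => a y z X'.
move: (ulsubmx W 0 0) (ursubmx W) (dlsubmx W) (drsubmx W) => w y' b' W'.
clear X W; set W := block_mx _ _ _ W'; set N := block_mx _ _ _ N'.
set X := block_mx _ _ _ X' => Wpsd lyap.
have lneg : l + l^* < 0.
  by have := Nneg (lshift n 0); rewrite block_mxEul mxE eqxx mulr1n.
have N'neg i : N' i i + (N' i i)^* < 0.
  by have := Nneg (rshift 1 i); rewrite block_mxEdr.
(* A zero diagonal entry would make [l + l^* + N' i i + (N' i i)^*] vanish. *)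
have Uunit : N' + (l^*)%:M \in unitmx.
  apply: trig_add_scalar_unit => // i.
  apply/eqP => Nl; have := ltrD lneg (N'neg i).
  have -> : l + l^* + (N' i i + (N' i i)^*)
    = (N' i i + l^*) + (N' i i + l^*)^* by rewrite rmorphD /= conjCK; ring.
  by rewrite Nl conjC0 addr0 ltxx.
have [Wh Wge0] := Wpsd.
move: (Wh); rewrite block_mx_adj !scalar_mx_adj => /eq_block_mx[_ _ y'b' _].
have [E11 E12 E21] : [/\ l * a + a * l^* + w = 0,
  l *: y + a *: b ^t* + y *m N' ^t* + y' = 0 &
  a *: b + N' *m z + l^* *: z + b' = 0].
  move: lyap; rewrite /N /X /W block_mx_adj !mulmx_block !add_block_mx.
  rewrite trmx0 map_mx0 scalar_mx_adj -[0 in RHS]block_mx0 => /eq_block_mx[].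
  rewrite !mul0mx !mulmx0 !addr0 -!scalar_mxM -!raddfD /= !mul_scalar_mx.
  rewrite !mul_mx_scalar => /matrixP/(_ 0 0); rewrite !mxE !mulr1n => -> <- <- _.
  by split=> //; rewrite ?addrA // [b *m _]mul_mx_scalar.
have a_ge0 : 0 <= a.
  have -> : a = w / - (l + l^*).
    have -> : w = a * - (l + l^*)
      by apply/eqP; rewrite -subr_eq0 -E11; apply/eqP; ring.
    by rewrite mulfK // oppr_eq0 lt_eqF.
  apply: divr_ge0; last by rewrite oppr_ge0 ltW.
  have := Wge0 (col_mx 1 0); rewrite /qform tr_col_mx map_row_mx trmx0 map_mx0.
  rewrite mul_row_block !mul0mx !addr0 mul_row_col mulmx0 addr0 mulmx1.
  by rewrite trmx1 map_mx1 mul1mx mxE mulr1n.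
have aR : a^* = a by apply/CrealP/ger0_real.
have zE : (N' + (l^*)%:M) *m z = - (a *: b + b').
  apply/eqP; rewrite -addr_eq0 -E21 mulmxDl mul_scalar_mx; apply/eqP.
  by rewrite addrACA addrA [_ + a *: b]addrC.
have zy : z = y ^t*.
  apply: (can_inj (mulKmx Uunit)); rewrite zE; apply/eqP; rewrite eq_sym -addr_eq0.
  have /(congr1 (fun M => M ^t*)) := E12; rewrite trmx0 map_mx0 => <-.
  rewrite !addmx_adj !scalemx_adj aR mulmx_adj !trmxCK y'b' mulmxDl mul_scalar_mx.
  by rewrite [N' *m _ + _]addrC addrACA addrA.
(* When [a = 0] its inverse is [0] too, and [y = a s] holds because [y = 0]. *)
pose s := a^-1 *: y.
have ys : y = a *: s.
  have [a0|a0] := eqVneq a 0; last by rewrite /s scalerA mulfV // scale1r.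
  suff z0 : z = 0 by rewrite a0 scale0r -[y]trmxCK -zy z0 trmx0 map_mx0.
  suff b'0 : b' = 0.
    by apply: (can_inj (mulKmx Uunit)); rewrite zE a0 b'0 scale0r mulmx0 addr0 oppr0.
  have w0 : w = 0 by rewrite -E11 a0 mul0r mulr0 !add0r.
  have : W *m col_mx 1 0 = 0.
    apply: hpsdmx_ker => //; rewrite /qform tr_col_mx map_row_mx trmx0 map_mx0.
    rewrite mul_row_block !mul0mx !addr0 mul_row_col mulmx0 addr0 mulmx1.
    by rewrite trmx1 map_mx1 mul1mx mxE w0 mul0rn.
  rewrite mul_block_col !mulmx0 !addr0 !mulmx1 -[0 in RHS]vsubmxK.
  by move=> /eq_col_mx[_ ->]; apply/matrixP => i j; rewrite !mxE.
have zs : z = a *: s ^t* by rewrite zy ys scalemx_adj aR.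
(* Compressing the equation by [E] eliminates the first row and column of [X]. *)
pose E : 'M[C]_(n, 1 + n) := row_mx (- s ^t*) 1%:M.
pose X2 := X' - a *: (s ^t* *m s).
have EX : E *m X = row_mx 0 X2.
  rewrite mul_row_block !mul1mx mul_mx_scalar zs ys scalerN addNr.
  by rewrite mulNmx -scalemxAr addrC.
have EadjE : E ^t* = col_mx (- s) 1%:M.
  by rewrite tr_row_mx map_col_mx oppmx_adj trmxCK trmx1 map_mx1.
have XE : X *m E ^t* = col_mx 0 X2.
  rewrite EadjE mul_block_col !mulmx1 mul_scalar_mx zs ys scalerN addNr.
  by rewrite mulmxN -scalemxAl addrC.
have X2psd : hpsdmx X2.
  apply: (IHn X2 (E *m W *m E ^t*)) => //; first exact: hpsdmx_congr.
  have -> : W = - (N *m X + X *m N ^t*) by apply/eqP; rewrite -addr_eq0 addrC lyap.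
  rewrite mulmxN mulNmx.
  have -> : E *m (N *m X + X *m N ^t*) *m E ^t*
    = (E *m N) *m (X *m E ^t*) + (E *m X) *m (E *m N) ^t*.
    by rewrite mulmxDr mulmxDl mulmx_adj !mulmxA.
  have [r EN] : exists r, E *m N = row_mx r N'.
    by rewrite mul_row_block mulmx0 add0r !mul1mx; eexists.
  rewrite EN XE EX tr_row_mx map_col_mx !mul_row_col mulmx0 mul0mx !add0r.
  by rewrite subrr.
pose G : 'M[C]_(1 + n) := block_mx 1%:M 0 (s ^t*) 1%:M.
have -> : X = G *m block_mx a%:M 0 0 X2 *m G ^t*.
  rewrite /G block_mx_adj !trmx1 !map_mx1 trmx0 map_mx0 trmxCK !mulmx_block.
  rewrite !(mul1mx, mulmx1, mul0mx, mulmx0, addr0, add0r) mul_scalar_mx -ys.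
  by rewrite /X zs mul_mx_scalar -scalemxAl addrC subrK.
exact/hpsdmx_congr/hpsdmx_block_diag.
Qed.

Lemma qformD n (X Y : 'M[C]_n) v : qform (X + Y) v = qform X v + qform Y v.
Proof. by rewrite /qform mulmxDr mulmxDl mxE. Qed.

Lemma qform_congr m n (G : 'M[C]_(m, n)) (X : 'M[C]_m) v :
  qform (G ^t* *m X *m G) v = qform X (G *m v).
Proof. by rewrite /qform mulmx_adj !mulmxA. Qed.

Lemma qform_lyapunov n (M X : 'M[C]_n) (x : 'cV[C]_n) (z : C) :
  M *m x = z *: x -> qform (M ^t* *m X + X *m M) x = (z + z^*) * qform X x.
Proof.
move=> Mx; rewrite qformD /qform mulmxA -mulmx_adj Mx -!mulmxA Mx !mulmxA.
by rewrite scalemx_adj -!(scalemxAl, scalemxAr) !mxE; ring.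
Qed.

End HermitianPsd.

(** * Real definiteness over the complex numbers *)

Section Complexification.
Local Open Scope sesquilinear_scope.
Variable F : realType.
Local Notation toC := (map_mx (real_complex F)).

Lemma map_real_complex_adj m n (M : 'M[F]_(m, n)) : (toC M) ^t* = toC M^T.
Proof.
apply/matrixP => i j; rewrite !mxE; apply/CrealP/complex_realP.
by exists (M j i).
Qed.

Lemma real_imaginary_mx m n (v : 'M[complex F]_(m, n)) :
  v = toC (map_mx (@complex.Re F) v) + 'i%C *: toC (map_mx (@complex.Im F) v).
Proof. by apply/matrixP => i j; rewrite !mxE [LHS]complexE. Qed.

(** The cross terms between the real and imaginary parts cancel by symmetry;
    this is what lets real definiteness speak about complex eigenvectors. *)
Lemma qform_map_real_complex n (M : 'M[F]_n) (v : 'cV[complex F]_n) : M^T = M ->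
  let a := map_mx (@complex.Re F) v in let b := map_mx (@complex.Im F) v in
  qform (toC M) v = real_complex F ((a^T *m M *m a) 0 0 + (b^T *m M *m b) 0 0).
Proof.
move=> Msym a b; rewrite /qform [in LHS](real_imaginary_mx v) -/a -/b.
have cross : b^T *m M *m a = a^T *m M *m b.
  apply/matrixP => i j; rewrite !ord1.
  have -> : b^T *m M *m a = (a^T *m M *m b)^T.
    by rewrite !trmx_mul trmxK Msym mulmxA.
  by rewrite mxE.
have adjE : (toC a + 'i%C *: toC b) ^t* = toC a^T - 'i%C *: toC b^T.
  rewrite addmx_adj scalemx_adj !map_real_complex_adj complexiE conjCi.
  by rewrite scaleNr.
rewrite adjE !(mulmxDl, mulmxDr, mulNmx) -!(scalemxAl, scalemxAr) -!map_mxM cross.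
move: (a^T *m M *m a) (a^T *m M *m b) (b^T *m M *m b) => x y z.
rewrite !mxE rmorphD /=.
have := sqr_i F; rewrite expr2 => i2.
by rewrite mulrA i2; ring.
Qed.

Lemma psdmx_complex n (M : 'M[F]_n) : psdmx M -> hpsdmx (toC M).
Proof.
move=> [Msym M0]; split; first by rewrite map_real_complex_adj Msym.
by move=> v; rewrite qform_map_real_complex // ler0c addr_ge0 // M0.
Qed.

Lemma complex_psdmx n (M : 'M[F]_n) : hpsdmx (toC M) -> psdmx M.
Proof.
move=> [Mh M0]; split.
  move: Mh; rewrite map_real_complex_adj => /matrixP Mh.
  by apply/matrixP => i j; have := Mh i j; rewrite [LHS]mxE [RHS]mxE => /complexI.
move=> x; have := M0 (toC x); rewrite /qform map_real_complex_adj -!map_mxM mxE.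
by rewrite ler0c.
Qed.

Lemma pdmx_complex_definite n (M : 'M[F]_n) (v : 'cV[complex F]_n) :
  pdmx M -> qform (toC M) v = 0 -> v = 0.
Proof.
move=> [Msym Mpos]; rewrite qform_map_real_complex //.
have nneg (x : 'cV[F]_n) : 0 <= (x^T *m M *m x) 0 0.
  have [->|x0] := eqVneq x 0; first by rewrite mulmx0 mxE.
  exact/ltW/Mpos.
move=> /complexI/eqP; rewrite paddr_eq0 // => /andP[re0 im0].
rewrite [v]real_imaginary_mx.
have definite (x : 'cV[F]_n) : (x^T *m M *m x) 0 0 == 0 -> x = 0.
  by move=> Mx0; apply: contraTeq Mx0 => x0; rewrite gt_eqF // Mpos.
by rewrite (definite _ re0) (definite _ im0) map_mx0 scaler0 addr0.
Qed.

End Complexification.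

(** * The Lyapunov equation of a Hurwitz matrix *)

Lemma eigenvalue_trmx (K : fieldType) n (M : 'M[K]_n) a :
  eigenvalue M^T a = eigenvalue M a.
Proof.
have eigE (N : 'M[K]_n) : eigenvalue N a = (\det (N - a%:M) == 0).
  apply/eigenvalueP/det0P => -[v]; last first.
    by move=> v0 /eqP; rewrite mulmxBr mul_mx_scalar subr_eq0 => /eqP; exists v.
  by move=> vN v0; exists v => //; rewrite mulmxBr vN mul_mx_scalar subrr.
by rewrite !eigE -[in RHS]det_tr linearB /= tr_scalar_mx.
Qed.

(** [eigenvalue] is defined by row vectors; the arguments below use columns. *)
Lemma right_eigenvectorP (K : fieldType) n (M : 'M[K]_n) a :
  reflect (exists2 x : 'cV[K]_n, x != 0 & M *m x = a *: x) (eigenvalue M a).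
Proof.
rewrite -eigenvalue_trmx; apply: (iffP eigenvalueP).
  move=> [v vM v0]; exists v^T; first by rewrite trmx_eq0.
  by apply: trmx_inj; rewrite trmx_mul !trmxK vM linearZ /= trmxK.
move=> [x x0 Mx]; exists x^T; last by rewrite trmx_eq0.
by rewrite -trmx_mul Mx linearZ.
Qed.

Section Lyapunov.
Local Open Scope sesquilinear_scope.
Variable F : realType.
Local Notation toC := (map_mx (real_complex F)).

(** A Schur decomposition [N = U M^T U^*] turns the equation into a triangular
    one; the diagonal of [N] consists of eigenvalues of [M]. *)
Lemma hurwitz_lyapunov_psd n (M X W : 'M[F]_n) :
  hurwitz M -> psdmx W -> M^T *m X + X *m M + W = 0 -> psdmx X.
Proof.
move=> Mhur Wpsd lyap; apply: complex_psdmx.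
case: n => [|n] in M X W Mhur Wpsd lyap *.
  rewrite [X]thinmx0 map_mx0; split; first by rewrite trmx0 map_mx0.
  by move=> v; rewrite /qform mulmx0 mul0mx mxE.
have [U Uunitary] := Schur (toC M^T) (ltn0Sn n).
have UU := unitarymx_unit Uunitary.
rewrite /similar_to conjymx // => NT.
move NE : (U *m toC M^T *m U ^t*) NT => N NT.
have UadjU : U ^t* *m U = 1%:M by rewrite -invmx_unitary // mulVmx.
have Npsd : hpsdmx (U *m toC X *m U ^t*).
  apply: (hpsdmx_lyapunov_trig NT _ (hpsdmx_congr U (psdmx_complex Wpsd))).
    move=> i.
    have /right_eigenvectorP[x x0 Nx] : eigenvalue N (N i i).
      rewrite eigenvalue_root_char char_poly_trig // (bigD1 i) //=.
      by rewrite rootM root_XsubC eqxx.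
    have : eigenvalue (toC M) (N i i).
      rewrite -eigenvalue_trmx map_trmx; apply/right_eigenvectorP.
      exists (U ^t* *m x).
        apply: contra_neq x0 => Ux0.
        by rewrite -[x](mulKVmx UU) invmx_unitary // Ux0 mulmx0.
      have -> : toC M^T = U ^t* *m N *m U.
        by rewrite -NE !mulmxA UadjU mul1mx -mulmxA UadjU mulmx1.
      rewrite -!mulmxA [U *m (_ *m x)]mulmxA -invmx_unitary // mulmxV //.
      by rewrite mul1mx Nx -scalemxAr.
    move=> /Mhur; case: (N i i) => re im /= re0.
    by rewrite ltcE /= subrr eqxx /= -mulr2n pmulrn_llt0.
  rewrite -NE !mulmx_adj trmxCK map_real_complex_adj trmxK.
  have mid (Y Z : 'M[complex F]_n.+1) :
    (U *m Y *m U ^t*) *m (U *m Z *m U ^t*) = U *m (Y *m Z) *m U ^t*.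
    by rewrite !mulmxA -[_ *m U^t* *m U]mulmxA UadjU mulmx1.
  rewrite [U *m (_ *m _)]mulmxA !mid -!mulmxDl -!mulmxDr -!map_mxM -!map_mxD lyap.
  by rewrite map_mx0 mulmx0 mul0mx.
have -> : toC X = U ^t* *m (U *m toC X *m U ^t*) *m U ^t* ^t*.
  by rewrite trmxCK !mulmxA UadjU mul1mx -mulmxA UadjU mulmx1.
exact: hpsdmx_congr.
Qed.

End Lyapunov.

(** * The Loewner order *)

Section RealPsd.
Variable F : realType.

Lemma psdmx_congr m n (G : 'M[F]_(m, n)) (X : 'M[F]_m) :
  psdmx X -> psdmx (G^T *m X *m G).
Proof.
move=> [Xsym X0]; split; first by rewrite !trmx_mul trmxK Xsym mulmxA.
by move=> x; have := X0 (G *m x); rewrite trmx_mul !mulmxA.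
Qed.

Lemma psdmxD n (X Y : 'M[F]_n) : psdmx X -> psdmx Y -> psdmx (X + Y).
Proof.
move=> [Xs X0] [Ys Y0]; split; first by rewrite linearD /= Xs Ys.
by move=> x; rewrite mulmxDr mulmxDl mxE addr_ge0.
Qed.

Lemma psdmx0 n : psdmx (0 : 'M[F]_n).
Proof. by split=> [|x]; rewrite ?trmx0 // mulmx0 mul0mx mxE. Qed.

Lemma pdmx_psd n (X : 'M[F]_n) : pdmx X -> psdmx X.
Proof.
move=> [Xs Xpos]; split=> // x.
have [->|x0] := eqVneq x 0; first by rewrite mulmx0 mxE.
exact/ltW/Xpos.
Qed.

Lemma pdmx_unit n (X : 'M[F]_n) : pdmx X -> X \in unitmx.
Proof.
move=> [Xs Xpos]; rewrite unitmxE unitfE; apply/negP => /det0P[v v0 vX].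
have := Xpos v^T; rewrite trmx_eq0 trmxK vX mul0mx mxE ltxx.
by move=> /(_ v0).
Qed.

Lemma form_delta n (X : 'M[F]_n) i j :
  ((delta_mx i 0 : 'cV[F]_n)^T *m X *m (delta_mx j 0 : 'cV[F]_n)) 0 0 = X i j.
Proof. by rewrite trmx_delta -rowE -colE !mxE. Qed.

(** Recovers the entries from the quadratic form, so that pointwise statements on
    forms become statements on symmetric matrices. *)
Lemma polarization n (X : 'M[F]_n) (i j : 'I_n) : X^T = X ->
  let e k : 'cV[F]_n := delta_mx k 0 in
  let q (x : 'cV[F]_n) := (x^T *m X *m x) 0 0 in
  X i j = (q (e i + e j) - q (e i) - q (e j)) / 2.
Proof.
move=> Xs e q; rewrite /q [(_ + _)^T]linearD /= !(mulmxDl, mulmxDr).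
have addE (M N : 'M[F]_1) : (M + N) 0 0 = M 0 0 + N 0 0 by rewrite mxE.
rewrite !addE !form_delta.
have -> : X j i = X i j by rewrite -[in LHS]Xs mxE.
by field.
Qed.

Lemma loewner_le_anti n (X Y : 'M[F]_n) :
  loewner_le X Y -> loewner_le Y X -> X = Y.
Proof.
move=> [XYs XY0] [_ YX0]; apply/eqP; rewrite eq_sym -subr_eq0; apply/eqP.
have q0 (x : 'cV[F]_n) : (x^T *m (Y - X) *m x) 0 0 = 0.
  apply/eqP; rewrite eq_le XY0 andbT; have := YX0 x.
  by rewrite -opprB mulmxN mulNmx mxE oppr_ge0.
apply/matrixP => i j; rewrite (polarization i j XYs) !q0 !mxE; ring.
Qed.

End RealPsd.

(** * Residuals of feedback gains *)

Section Riccati.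
Local Open Scope sesquilinear_scope.
Variables (F : realType) (n m : nat).
Variables (A : 'M[F]_n) (B : 'M[F]_(n, m)) (Q : 'M[F]_n) (R : 'M[F]_m).
Local Notation toC := (map_mx (real_complex F)).

(** For a stabilizing [L], zero exactly when [P] is the infinite-horizon cost
    matrix of the feedback [u = L x]. *)
Definition policy_residual (L : 'M[F]_(m, n)) (P : 'M[F]_n) : 'M[F]_n :=
  (A + B *m L)^T *m P + P *m (A + B *m L) + Q + L^T *m R *m L.

Definition riccati_residual (P : 'M[F]_n) : 'M[F]_n :=
  A^T *m P + P *m A + Q - P *m B *m invmx R *m B^T *m P.

(** Since [R] times the gain of [P] is [- B^T P], the terms of the residual that
    contain [L] form a square: [P] pays exactly this square for using [L]
    instead of its own gain. All comparisons of costs come from this identity. *)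
Lemma complete_square L P : pdmx R -> P^T = P ->
  policy_residual L P = riccati_residual P
    + (L - lqr_gain B R P)^T *m R *m (L - lqr_gain B R P).
Proof.
move=> Rpd Ps; have RU := pdmx_unit Rpd; have [Rs _] := Rpd.
rewrite /lqr_gain opprK; move GE : (invmx R *m B^T *m P) => G.
have RG : R *m G = B^T *m P by rewrite -GE !mulmxA mulmxV // mul1mx.
have GR : G^T *m R = P *m B.
  by rewrite -[R]trmxK -trmx_mul Rs RG trmx_mul trmxK Ps.
have GRG : P *m B *m invmx R *m B^T *m P = G^T *m R *m G.
  by rewrite GR -GE !mulmxA.
rewrite /policy_residual /riccati_residual GRG !linearD /= trmx_mul.
rewrite !(mulmxDl, mulmxDr) -[L^T *m R *m G]mulmxA RG GR !mulmxA.
move: (A^T *m P) (P *m A) => a b; move: (L^T *m B^T *m P) (P *m B *m L) => c d.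
move: (L^T *m R *m L) (P *m B *m G) => e f.
by apply/matrixP => i j; rewrite !mxE; ring.
Qed.

(** The residual is affine in its last argument, so [Y - X] solves a Lyapunov
    equation whose constant term is the difference of the residuals. *)
Lemma policy_residual_le L X Y : hurwitz (A + B *m L) ->
  psdmx (policy_residual L X - policy_residual L Y) -> loewner_le X Y.
Proof.
move=> Lhur Wpsd; apply: hurwitz_lyapunov_psd Lhur Wpsd _.
rewrite /policy_residual mulmxBr mulmxBl.
move: (_^T *m Y) (Y *m _) (_^T *m X) (X *m _) (L^T *m R *m L) => a b c d e.
by apply/matrixP => i j; rewrite !mxE; ring.
Qed.

(** Let [x] be an eigenvector of [A + B L] for [z] with [Re z >= 0]. The form of
    the equation at [x] is a sum of nonnegative terms, hence [S x = 0] and, as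
    [R] is definite, [L x = 0]. Then [x] is also an eigenvector, for the same
    [z], of [A] corrected by any output injection from [S], and detectability
    excludes this. *)
Lemma detectable_policy_hurwitz S L P W : is_psd_sqrt Q S -> detectable A S ->
  pdmx R -> psdmx P -> psdmx W -> policy_residual L P + W = 0 ->
  hurwitz (A + B *m L).
Proof.
move=> [[Ssym _] SQ] [H Hhur] Rpd Ppsd Wpsd res z.
move=> /right_eigenvectorP[x x0 Mx]; rewrite ltNge; apply/negP => Rez.
have zz : 0 <= z + z^*.
  by case: z {Mx} Rez => re im /= re0; rewrite lecE /= subrr eqxx addr_ge0.
have Rpsd := pdmx_psd Rpd.
have qS : qform (toC Q) x = ((toC S *m x) ^t* *m (toC S *m x)) 0 0.
  by rewrite -SQ -{1}Ssym map_mxM -map_real_complex_adj -[_ ^t*]mulmx1 qform_congr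
    /qform mulmx1.
have qR : qform (toC (L^T *m R *m L)) x = qform (toC R) (toC L *m x).
  by rewrite !map_mxM -map_real_complex_adj qform_congr.
have sum0 : (z + z^*) * qform (toC P) x + qform (toC Q) x
    + qform (toC (L^T *m R *m L)) x + qform (toC W) x = 0.
  rewrite -(qform_lyapunov (toC P) Mx) map_real_complex_adj.
  rewrite -!map_mxM -!map_mxD -!qformD -!map_mxD.
  move: res; rewrite /policy_residual => ->.
  by rewrite map_mx0 /qform mulmx0 mul0mx mxE.
have P0 := (psdmx_complex Ppsd).2 x; have W0 := (psdmx_complex Wpsd).2 x.
have R0 := (psdmx_complex Rpsd).2 (toC L *m x); rewrite -qR in R0.
have Q0 := adj_mul_ge0 (toC S *m x); rewrite -qS in Q0.
have zP0 := mulr_ge0 zz P0.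
move/eqP: sum0; rewrite paddr_eq0 ?addr_ge0 // => /andP[+ _].
rewrite paddr_eq0 ?addr_ge0 // => /andP[+ /eqP qR0].
rewrite paddr_eq0 // => /andP[_ /eqP qQ0].
have Sx : toC S *m x = 0 by apply: adj_mul_eq0; rewrite -qS.
have Lx : toC L *m x = 0 by apply: pdmx_complex_definite Rpd _; rewrite -qR.
have : complex.Re z < 0; last by rewrite ltNge Rez.
apply: Hhur; apply/right_eigenvectorP; exists x => //.
rewrite -Mx !map_mxD !map_mxM !mulmxDl -!mulmxA.
by rewrite Sx Lx !mulmx0.
Qed.

End Riccati.

(** * Convergence of matrices *)

Section Convergence.
Variable F : realType.

Lemma cvg_mxP m n (u : nat -> 'M[F]_(m, n)) (l : 'M[F]_(m, n)) :
  u @ \oo --> l <-> forall i j, u k i j @[k --> \oo] --> l i j.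
Proof.
split=> [ul i j|ul A].
  exact: (cvg_comp _ _ ul (@coord_continuous F m n i j l)).
move=> [P Pl PA]; have near_P : \forall k \near \oo, forall i j, P i j (u k i j).
  apply: filter_forall => i; apply: filter_forall => j.
  exact: (ul i j _ (Pl i j)).
by apply: filterS near_P => k Pk; exact: PA.
Qed.

Lemma cvg_mulmx m n p (u : nat -> 'M[F]_(m, n)) (v : nat -> 'M[F]_(n, p))
    (a : 'M[F]_(m, n)) (b : 'M[F]_(n, p)) :
  u @ \oo --> a -> v @ \oo --> b -> u k *m v k @[k --> \oo] --> a *m b.
Proof.
move=> /cvg_mxP ua /cvg_mxP vb; apply/cvg_mxP => i j.
rewrite mxE; under eq_fun do rewrite mxE.
by apply: cvg_big => [|r _]; [exact: add_continuous|exact: cvgM].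
Qed.

Lemma cvg_trmx m n (u : nat -> 'M[F]_(m, n)) (a : 'M[F]_(m, n)) :
  u @ \oo --> a -> (u k)^T @[k --> \oo] --> a^T.
Proof.
move=> /cvg_mxP ua; apply/cvg_mxP => i j.
by rewrite mxE; under eq_fun do rewrite mxE; exact: ua.
Qed.

Lemma cvg_psdmx n (u : nat -> 'M[F]_n) (l : 'M[F]_n) :
  u @ \oo --> l -> (forall k, psdmx (u k)) -> psdmx l.
Proof.
move=> ul u0; split=> [|x].
  apply/esym; apply: (cvg_unique _ ul); rewrite //.
  have -> : u = fun k => (u k)^T by apply: funext => k; have [] := u0 k.
  exact: cvg_trmx.
have /cvg_mxP/(_ 0 0) qcvg : x^T *m u k *m x @[k --> \oo] --> x^T *m l *m x.
  by apply: cvg_mulmx; [apply: cvg_mulmx => //; exact: cvg_cst|exact: cvg_cst].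
rewrite -(cvg_lim _ qcvg) //; apply: limr_ge.
  by apply/cvg_ex; eexists; exact: qcvg.
by apply: nearW => k; have [_] := u0 k; apply.
Qed.

(** For each vector the forms decrease and are bounded below, hence converge;
    polarization turns this into convergence of the entries. *)
Lemma loewner_monotone_cvg n (u : nat -> 'M[F]_n) (lb : 'M[F]_n) :
  (forall k, (u k)^T = u k) ->
  (forall k, loewner_le (u k.+1) (u k)) -> (forall k, loewner_le lb (u k)) ->
  exists2 l, u @ \oo --> l & loewner_le lb l.
Proof.
move=> usym udec ulb.
pose q (x : 'cV[F]_n) (k : nat) : F := (x^T *m u k *m x) 0 0.
have le_form X Y (x : 'cV[F]_n) :
    loewner_le X Y -> (x^T *m X *m x) 0 0 <= (x^T *m Y *m x) 0 0.
  by move=> [_ /(_ x)]; rewrite mulmxBr mulmxBl !mxE subr_ge0.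
have qcvg x : cvgn (q x).
  apply: nonincreasing_is_cvgn.
    by apply/nonincreasing_seqP => k; exact: le_form.
  by exists ((x^T *m lb *m x) 0 0) => _ [k _ <-]; exact: le_form.
pose e i : 'cV[F]_n := delta_mx i 0.
pose l : 'M[F]_n := \matrix_(i, j)
  ((limn (q (e i + e j)) - limn (q (e i)) - limn (q (e j))) / 2).
have ul : u @ \oo --> l.
  apply/cvg_mxP => i j; rewrite mxE.
  under eq_fun do rewrite (polarization i j (usym _)).
  apply: cvgM; last exact: cvg_cst.
  by apply: cvgB; [apply: cvgB|]; exact: qcvg.
exists l => //; apply: (cvg_psdmx (u := fun k => u k - lb)) => //.
by apply: cvgB => //; exact: cvg_cst.
Qed.

End Convergence.

(** * Kleinman's algorithm *)

Theorem theorem6 (F : realType) (n m : nat)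
    (A : 'M[F]_n) (B : 'M[F]_(n, m)) (Q : 'M[F]_n) (R : 'M[F]_m)
    (psdQ : psdmx Q) (pdR : pdmx R)
    (stabAB : stabilizable A B)
    (sqrtQ : 'M[F]_n) (sqrtQE : is_psd_sqrt Q sqrtQ)
    (detAQ : detectable A sqrtQ)
    (Pstar : 'M[F]_n) (psdPstar : psdmx Pstar)
    (arePstar : riccati_eq A B Q R Pstar)
    (K0 : 'M[F]_(m, n)) (hurK0 : hurwitz (A + B *m K0))
    (P : nat -> 'M[F]_n) (K : nat -> 'M[F]_(m, n))
    (kleinman : kleinman_iteration A B Q R K0 P K) :
  (forall k : nat, hurwitz (A + B *m K k)) /\
  (forall k : nat,
     loewner_le Pstar (P k.+1) /\ loewner_le (P k.+1) (P k)) /\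
  ((K @ \oo --> lqr_gain B R Pstar) /\ (P @ \oo --> Pstar)).
Proof.
case: kleinman => K0E step.
have resK k : policy_residual A B Q R (K k) (P k) = 0 by have [/esym] := step k.
have gainK k : K k.+1 = lqr_gain B R (P k) by have [_ ->] := step k.
have square_psd (L : 'M[F]_(m, n)) : psdmx (L^T *m R *m L).
  exact/psdmx_congr/pdmx_psd.
(* The square by which [L] misses the gain of [X]. *)
pose gap L X := (L - lqr_gain B R X)^T *m R *m (L - lqr_gain B R X).
have Pstar_sym := psdPstar.1.
have res_gap L X : X^T = X -> policy_residual A B Q R L X
    = policy_residual A B Q R (lqr_gain B R X) X + gap L X.
  move=> Xs; rewrite !(complete_square _ _ _ _ pdR Xs) subrr.
  by rewrite trmx0 !mul0mx addr0.
have resPstar : policy_residual A B Q R (lqr_gain B R Pstar) Pstar = 0.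
  rewrite (complete_square _ _ _ _ pdR Pstar_sym) subrr trmx0 !mul0mx addr0.
  exact: arePstar.
have P_psd k : hurwitz (A + B *m K k) -> psdmx (P k).
  move=> hurk; apply: hurwitz_lyapunov_psd hurk (psdmxD psdQ (square_psd (K k))) _.
  by rewrite addrA; exact: resK.
have res_next k : (P k)^T = P k ->
    policy_residual A B Q R (K k.+1) (P k) + gap (K k) (P k) = 0.
  by move=> Ps; rewrite -[RHS](resK k) gainK -res_gap.
have hurK k : hurwitz (A + B *m K k).
  elim: k => [|k hurk]; first by rewrite K0E.
  have Ppsd := P_psd k hurk.
  exact: detectable_policy_hurwitz sqrtQE detAQ pdR Ppsd (square_psd _)
    (res_next k Ppsd.1).
have P_sym k : (P k)^T = P k := (P_psd k (hurK k)).1.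
have Pdec k : loewner_le (P k.+1) (P k).
  apply: (policy_residual_le (Q := Q) (R := R) (hurK k.+1)).
  rewrite resK sub0r -[X in psdmx X]addr0 -(res_next k (P_sym k)) addKr.
  exact: square_psd.
have Plb k : loewner_le Pstar (P k).
  apply: (policy_residual_le (Q := Q) (R := R) (hurK k)).
  rewrite resK subr0 (res_gap _ _ Pstar_sym) resPstar add0r.
  exact: square_psd.
have [Pinf Pcvg Pinf_lb] := loewner_monotone_cvg P_sym Pdec Plb.
have gain_cvg : lqr_gain B R (P k) @[k --> \oo] --> lqr_gain B R Pinf.
  apply: cvgN; apply: cvg_mulmx (Pcvg); exact: cvg_cst.
have Kcvg : K @ \oo --> lqr_gain B R Pinf.
  by rewrite -cvg_shiftS; under eq_fun do rewrite gainK.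
have Pinf_sym : Pinf^T = Pinf.
  have := psdmxD (conj Pstar_sym psdPstar.2) Pinf_lb; rewrite subrKC.
  by case.
have resPinf : policy_residual A B Q R (lqr_gain B R Pinf) Pinf = 0.
  have Acl_cvg : A + B *m K k @[k --> \oo] --> A + B *m lqr_gain B R Pinf.
    by apply: cvgD; [exact: cvg_cst|apply: cvg_mulmx (Kcvg); exact: cvg_cst].
  have res_cvg : policy_residual A B Q R (K k) (P k) @[k --> \oo] -->
      policy_residual A B Q R (lqr_gain B R Pinf) Pinf.
    apply: cvgD; last first.
      apply: cvg_mulmx (Kcvg); apply: cvg_mulmx; last exact: cvg_cst.
      exact: (cvg_trmx Kcvg).
    apply: cvgD; last exact: cvg_cst.
    apply: cvgD; last exact: (cvg_mulmx Pcvg Acl_cvg).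
    exact: (cvg_mulmx (cvg_trmx Acl_cvg) Pcvg).
  have res0 : (fun k => policy_residual A B Q R (K k) (P k)) = fun=> 0.
    by apply: funext => k; exact: resK.
  rewrite res0 in res_cvg.
  exact: (cvg_unique _ res_cvg (cvg_cst _)).
have hur_star : hurwitz (A + B *m lqr_gain B R Pstar).
  apply: detectable_policy_hurwitz sqrtQE detAQ pdR psdPstar (psdmx0 _ _) _.
  by rewrite addr0.
(* The converse bound: both [Pinf] and [Pstar] solve the Riccati equation, so under
   the stabilizing gain of [Pstar] the residual of [Pinf] is a square. *)
have Pinf_ub : loewner_le Pinf Pstar.
  apply: (policy_residual_le (Q := Q) (R := R) hur_star).
  rewrite resPstar subr0 (res_gap _ _ Pinf_sym) resPinf add0r.
  exact: square_psd.
have PinfE : Pinf = Pstar := loewner_le_anti Pinf_ub Pinf_lb.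
by rewrite PinfE in Pcvg Kcvg; split.
Qed.
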